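(* Let $M$ be a non-negative square matrix. For any non-negative matrix $D$ in $\mathrm{Dil}(M)$, the matrices $M$ and $D$ have the same spectral radius.
   Context: The spectral radius of a square matrix is the maximum of the moduli of its complex eigenvalues. Let $M$ be a real square matrix of size $m$. A real square matrix $D$ of size $n\ge m$ is called a dilated matrix of $M$ if there exist positive integers $k_1,\ldots,k_m$ with $\sum_{i=1}^m k_i=n$ such that, indexing both rows and columns of $D$ by pairs $(i,k)$ with $1\le i\le m$ and $1\le k\le k_i$, one has $$\forall i,j\in\{1,\ldots,m\},\ \forall k\in\{1,\ldots,k_i\},\qquad \sum_{\ell=1}^{k_j}D_{(i,k),(j,\ell)}=M_{i,j}.$$ $\mathrm{Dil}(M)$ denotes the set of dilated matrices of $M$. *)

(* Defs.v *)
From HB Require Import structures.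
From mathcomp Require Import all_boot all_order all_algebra.
From mathcomp Require Import classical_sets reals.
From mathcomp Require Import complex.

Set Implicit Arguments.
Unset Strict Implicit.
Unset Printing Implicit Defensive.

Import Order.TTheory GRing.Theory Num.Theory.
Local Open Scope ring_scope.
Local Open Scope classical_set_scope.

Definition nonneg_mx (R : realType) (m n : nat) (A : 'M[R]_(m, n)) : Prop :=
  forall i j, 0 <= A i j.

Definition complex_mx (R : realType) (n : nat) (A : 'M[R]_n) : 'M[R[i]]_n :=
  map_mx (real_complex R) A.

(* [`|z|] is the modulus seen in [R[i]]; its real part is the modulus in [R]. *)
Definition eigenvalue_moduli (R : realType) (n : nat) (A : 'M[R]_n) : set R :=
  [set complex.Re `|z| | z in [set z : R[i] | eigenvalue (complex_mx A) z]].

(* The supremum is a maximum as soon as [0 < n]: see [spectral_radiusP].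
   The 0 x 0 matrix has no eigenvalue and gets the value [sup set0 = 0]. *)
Definition spectral_radius (R : realType) (n : nat) (A : 'M[R]_n) : R :=
  sup (eigenvalue_moduli A).

(* The indexing of the rows and columns of [D] by the pairs (i, k) is an
   arbitrary bijection [e], the same for rows and columns; the consecutive
   blocks of the lexicographic order are a special case.  The pair (i, k) is
   [Tagged _ k : {i : 'I_m & 'I_(d i)}]. *)
Definition dilated (R : realType) (m n : nat) (M : 'M[R]_m) (D : 'M[R]_n) :
    Prop :=
  exists (d : 'I_m -> nat) (e : {i : 'I_m & 'I_(d i)} -> 'I_n),
    [/\ forall i, (0 < d i)%N,
        (\sum_(i < m) d i)%N = n,
        bijective e
      & forall (i j : 'I_m) (k : 'I_(d i)),
          \sum_(l < d j) D (e (Tagged (fun i => 'I_(d i)) k))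
                           (e (Tagged (fun i => 'I_(d i)) l)) = M i j].

Definition Dil (R : realType) (m n : nat) (M : 'M[R]_m) : set 'M[R]_n :=
  [set D | dilated M D].

Lemma eigenvalue_moduliP (R : realType) (n : nat) (A : 'M[R]_n) :
  exists s : seq R, forall x, eigenvalue_moduli A x <-> x \in s.
Proof.
have [r Er] := closed_field_poly_normal (char_poly (complex_mx A)).
exists [seq complex.Re `|z| | z <- r] => x.
have rE z : eigenvalue (complex_mx A) z = (z \in r).
  rewrite eigenvalue_root_char Er rootZ ?root_prod_XsubC //.
  by rewrite (monicP (char_poly_monic _)) oner_eq0.
split=> [[z /= zA <-]|/mapP[z zr ->]]; first by rewrite map_f // -rE.
by exists z => //=; rewrite rE.
Qed.

Lemma spectral_radiusP (R : realType) (n : nat) (A : 'M[R]_n) :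
  (0 < n)%N ->
  eigenvalue_moduli A (spectral_radius A) /\
  (forall x, eigenvalue_moduli A x -> x <= spectral_radius A).
Proof.
move=> n0; have [s sP] := eigenvalue_moduliP A.
have [z zA] : exists z, root (char_poly (complex_mx A)) z.
  by apply/closed_rootP; rewrite size_char_poly eqSS -lt0n.
have s0 : complex.Re `|z| \in s.
  by apply/sP; exists z => //=; rewrite eigenvalue_root_char.
have [y ys ymax] : exists2 y, y \in s & forall x, x \in s -> x <= y.
  move: s0; move: (complex.Re _) => x xs; have {x xs} : s != [::] by case: s xs {sP}.
  elim: s {sP} => // a [|b s] IH _.
    by exists a; rewrite ?mem_head // => t; rewrite inE => /eqP ->.
  have [y ys ymax] := IH isT.
  case: (leP a y) => ay.
    exists y; first by rewrite in_cons ys orbT.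
    by move=> t; rewrite in_cons => /predU1P[->|/ymax].
  exists a; first exact: mem_head.
  move=> t; rewrite in_cons => /predU1P[->//|/ymax ty].
  exact: le_trans ty (ltW ay).
have ub : ubound (eigenvalue_moduli A) y by move=> x /sP /ymax.
suff -> : spectral_radius A = y by split; [exact/sP | exact: ub].
apply/eqP; rewrite eq_le; apply/andP; split.
  by apply: ge_sup => //; exists y; apply/sP.
by apply: ub_le_sup; [exists y | apply/sP].
Qed.

(* Main.v *)
(** Let [b] map a pair (i, k) to i. Then [D (w \o b) = (M w) \o b], so
    every eigenvalue of [M] is one of [D]. Conversely, if [D w = z w], then
    [u i := max_(b p = i) |w p|] satisfies [|z| u <= M u] entrywise, and a
    non-negative matrix with such a subinvariant vector has a real eigenvalue
    [t >= |z|]. This last fact is obtained without compactness or power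
    iteration: [t] is the supremum of the reals [s] for which [s - M] fails to
    be inverse-positive. If [t - M] were invertible, it would be
    inverse-positive by perturbation from above, and then so would be [s - M]
    for [s] slightly below [t]. *)
Require Import Defs.
From mathcomp Require Import all_boot all_order all_algebra.
From mathcomp Require Import classical_sets reals.
From mathcomp Require Import boolp complex lra.

Set Implicit Arguments.
Unset Strict Implicit.
Unset Printing Implicit Defensive.

Import Order.TTheory GRing.Theory Num.Theory.
Local Open Scope ring_scope.
Local Open Scope classical_set_scope.

Section RightEigenvector.
Variables (F : fieldType) (n : nat).
Implicit Types (A : 'M[F]_n) (a : F).

Lemma eigenvalueNunit A a : eigenvalue A a = (a%:M - A \notin unitmx).
Proof.
by rewrite /eigenvalue /eigenspace kermx_eq0 row_free_unit -opprB -scaleN1r unitmxZ ?unitrN1.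
Qed.

Lemma eigenvalue_tr A a : eigenvalue A^T a = eigenvalue A a.
Proof. by rewrite !eigenvalueNunit -[in RHS]unitmx_tr linearB /= tr_scalar_mx. Qed.

(** [eigenvalue] is defined through row vectors, while dilation constrains row sums and so acts on
    column vectors; transposition preserves the spectrum. *)
Lemma right_eigenvalueP A a :
  reflect (exists2 v : 'cV_n, A *m v = a *: v & v != 0) (eigenvalue A a).
Proof.
rewrite -eigenvalue_tr; apply: (iffP eigenvalueP) => -[v vA v0]; exists v^T.
- by rewrite -[A]trmxK -trmx_mul vA linearZ.
- by rewrite trmx_eq0.
- by rewrite -trmx_mul vA linearZ.
- by rewrite trmx_eq0.
Qed.

End RightEigenvector.

Section InversePositive.
Variable R : realType.

Lemma nonneg_mxM (m n p : nat) (A : 'M[R]_(m, n)) (B : 'M_(n, p)) :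
  nonneg_mx A -> nonneg_mx B -> nonneg_mx (A *m B).
Proof.
by move=> A0 B0 i j; rewrite mxE sumr_ge0 // => k _; rewrite mulr_ge0.
Qed.

Lemma ler_row_sum (m n : nat) (A : 'M[R]_(m, n)) i :
  nonneg_mx A -> \sum_j A i j <= \sum_i \sum_j A i j.
Proof.
move=> A0; rewrite [leRHS](bigD1 i) //= lerDl sumr_ge0 // => k _.
by rewrite sumr_ge0.
Qed.

(** Monotone matrices in the sense of Collatz, phrased without an inverse so that the property can
    be tested before invertibility is known. *)
Definition inverse_positive (n : nat) (A : 'M[R]_n) : Prop :=
  forall x : 'cV_n, nonneg_mx (A *m x) -> nonneg_mx x.

(* Look at the row of a minimal entry of the vector. *)
Lemma dominant_inverse_positive (n : nat) (A : 'M[R]_n) t :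
  nonneg_mx A -> (forall i, \sum_j A i j < t) ->
  inverse_positive (t%:M - A).
Proof.
move=> A0 At x Ax0 i j; rewrite ord1 {j}.
case: (@arg_minP _ R _ i xpredT (fun k => x k 0) isT) => k _ kmin.
apply: le_trans (kmin i isT); rewrite leNgt; apply/negP => xk.
have := Ax0 k 0; rewrite mulmxBl mul_scalar_mx !mxE subr_ge0.
apply/negP; rewrite -ltNge.
apply: (@lt_le_trans _ _ (\sum_j A k j * x k 0)).
  by rewrite -mulr_suml ltr_nM2r.
by apply: ler_sum => j _; rewrite ler_wpM2l // kmin.
Qed.

Lemma inverse_positive_lim (n : nat) (M : 'M[R]_n) t :
  t%:M - M \in unitmx -> (forall s, t < s -> inverse_positive (s%:M - M)) ->
  inverse_positive (t%:M - M).
Proof.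
move=> tu Pgt x x0 i j; rewrite ord1 {j}.
(* Adding [d *: z] to [x] raises every entry of the image by [d]; this margin pays for moving from
   [t] to [t + d / c]. *)
pose z : 'cV_n := invmx (t%:M - M) *m const_mx 1.
have small d : 0 < d -> 0 <= x i 0 + d * z i 0.
  move=> d0; pose y := x + d *: z.
  have -> : x i 0 + d * z i 0 = y i 0 by rewrite !mxE.
  have My : (t%:M - M) *m y = (t%:M - M) *m x + d *: const_mx 1.
    by rewrite mulmxDr -scalemxAr mulKVmx.
  clearbody y.
  (* [c] dominates every [|y k 0|], so [(d / c) * y k 0 >= - d]; the summand 1 keeps [c] positive
     when [y] is zero. *)
  pose c := 1 + \sum_k `|y k 0|.
  have c0 : 0 < c by rewrite ltr_pwDl // sumr_ge0.
  have := Pgt (t + d / c) _ y _ i 0; apply.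
    by rewrite ltrDl divr_gt0.
  have -> : (t + d / c)%:M - M = (t%:M - M) + (d / c)%:M.
    by rewrite raddfD /= addrAC.
  rewrite mulmxDl My mul_scalar_mx => k l.
  have := x0 k l; move: (_ *m x) => X Xkl; rewrite !mxE -addrA addr_ge0 //.
  rewrite ord1 mulr1 -mulrA -{1}[d]mulr1 -mulrDr mulr_ge0 ?(ltW d0) //.
  have yc : `|y k 0| <= c.
    by rewrite /c (bigD1 k) //= addrCA lerDl addr_ge0 // sumr_ge0.
  rewrite -(@pmulr_lge0 _ c) // mulrDl mul1r mulrAC mulVf ?gt_eqF // mul1r.
  by have := ler_norm (- y k 0); rewrite normrN; lra.
rewrite leNgt; apply/negP => xi.
have z0 : 0 < 1 + `|z i 0| by rewrite ltr_pwDl.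
(* For this [d], [x i 0 + d * z i 0] is [x i 0] times [1 - z i 0 / (1 + |z i 0|)], a positive
   factor, hence negative. *)
have := small (- x i 0 / (1 + `|z i 0|)); rewrite divr_gt0 ?oppr_gt0 // => /(_ isT).
apply/negP; rewrite -ltNge -(@pmulr_llt0 _ (1 + `|z i 0|)) // mulrDl.
rewrite mulrAC divfK ?gt_eqF // mulNr -mulrBr nmulr_rlt0 //.
by have := ler_norm (z i 0); lra.
Qed.

Lemma inverse_positive_inv (n : nat) (A : 'M[R]_n) :
  A \in unitmx -> inverse_positive A -> nonneg_mx (invmx A).
Proof.
move=> Au AP i j; have := AP (col j (invmx A)) _ i 0; rewrite mxE; apply.
rewrite colE mulmxA mulmxV // mul1mx => k l; rewrite mxE; exact: ler0n.
Qed.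

(** With [N] the inverse of [t - M], [N (s - M) = 1 - (t - s) N]. Since [N >= 0], row dominance
    applies to the right side once [t - s] is small. *)
Lemma inverse_positive_open (n : nat) (M : 'M[R]_n) t :
  t%:M - M \in unitmx -> inverse_positive (t%:M - M) ->
  exists2 e, 0 < e & forall s, t - e < s -> s <= t -> inverse_positive (s%:M - M).
Proof.
move=> tu tP; set N := invmx (t%:M - M).
have N0 : nonneg_mx N by exact: inverse_positive_inv.
pose c := 1 + \sum_i \sum_j N i j.
have c0 : 0 < c by rewrite ltr_pwDl // sumr_ge0 // => i _; rewrite sumr_ge0.
exists c^-1; rewrite ?invr_gt0 // => s ts st x x0.
apply: (@dominant_inverse_positive n ((t - s) *: N) 1 _ _ x).
- by move=> i j; rewrite mxE mulr_ge0 // subr_ge0.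
- move=> i; under eq_bigr do rewrite mxE; rewrite -mulr_sumr.
  have ts' : t - s < c^-1 by lra.
  have : (t - s) * c < 1 by rewrite -ltr_pdivlMr // div1r.
  apply: le_lt_trans; rewrite ler_wpM2l ?subr_ge0 // /c.
  by rewrite (le_trans (ler_row_sum i N0)) // lerDr.
have -> : (1%:M - (t - s) *: N) *m x = N *m ((s%:M - M) *m x).
  rewrite mulmxA; congr (_ *m x).
  have -> : s%:M - M = (t%:M - M) - (t - s)%:M.
    by rewrite [(t - s)%:M]raddfB /= opprB [RHS]addrC addrA subrK.
  by rewrite mulmxBr mulVmx // mul_mx_scalar.
exact: nonneg_mxM.
Qed.

Lemma subinvariant_eigenvalue (n : nat) (M : 'M[R]_n) (u : 'cV_n) r :
  nonneg_mx M -> nonneg_mx u -> u != 0 -> nonneg_mx (M *m u - r *: u) ->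
  exists2 t, r <= t & eigenvalue M t.
Proof.
move=> M0 u0 un0 Mu.
pose T := [set s | ~ inverse_positive (s%:M - M)].
(* The witness is [- u]: its image under [r - M] is [M u - r u >= 0], yet [- u] is not
   non-negative. *)
have Tr : T r.
  move=> /(_ (- u)) H; case/eqP: un0; apply/matrixP => i j.
  have /H /(_ i j) : nonneg_mx ((r%:M - M) *m (- u)).
    by rewrite mulmxN -mulNmx opprB mulmxBl mul_scalar_mx.
  by have := u0 i j; rewrite !mxE; lra.
(* Beyond this bound [s] exceeds every row sum of [M]. *)
have Tub : ubound T (1 + \sum_i \sum_j M i j).
  move=> s Ts; rewrite leNgt; apply/negP => Ms; apply: Ts.
  apply: dominant_inverse_positive => // i.
  by apply: le_lt_trans Ms; rewrite (le_trans (ler_row_sum i M0)) // lerDr.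
have Thas : has_sup T by split; [exists r | exists (1 + \sum_i \sum_j M i j)].
have supT s : T s -> s <= sup T by apply: ub_le_sup; case: Thas.
exists (sup T); first exact: supT.
rewrite eigenvalueNunit; apply/negP => tu.
have tP : inverse_positive ((sup T)%:M - M).
  apply: inverse_positive_lim => // s ts; apply: contrapT => /supT.
  by rewrite leNgt ts.
have [e e0 eP] := inverse_positive_open tu tP.
have [s Ts es] := sup_adherent e0 Thas.
by apply: (Ts); apply: eP => //; apply: supT.
Qed.

End InversePositive.

Section Blocks.
Variables (R : realType) (m n : nat) (M : 'M[R]_m) (D : 'M[R]_n).

(** Trades the dependent pairs for the map [b] to the first component; positive block sizes become
    surjectivity. *)
Lemma dilated_blocks : dilated M D ->
  exists b : 'I_n -> 'I_m, (forall i, exists p, b p = i) /\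
    forall p j, \sum_(q | b q == j) D p q = M (b p) j.
Proof.
case=> d [e [d0 _ [f ef fe] DM]]; exists (fun p => tag (f p)); split.
  by move=> i; exists (e (Tagged (fun i => 'I_(d i)) (Ordinal (d0 i)))); rewrite ef.
move=> p j; rewrite -(fe p); case: (f p) => i k /=.
rewrite ef /= -(DM i j k) (reindex e) /=; last by exists f => x _.
under eq_bigl do rewrite ef.
have := @sig_big_dep _ _ +%R _ (fun i => 'I_(d i)) (pred1 j) (fun _ => xpredT)
  (fun j l => D (e (Tagged (fun i => 'I_(d i)) k)) (e (Tagged (fun i => 'I_(d i)) l))).
rewrite big_pred1_eq => ->.
by apply: eq_big => [x|[x y] _] //=; rewrite andbT.
Qed.

Variable b : 'I_n -> 'I_m.
Hypothesis b_surj : forall i, exists p, b p = i.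
Hypothesis DM : forall p j, \sum_(q | b q == j) D p q = M (b p) j.

Lemma blocks_eigenvalue z :
  eigenvalue (complex_mx M) z -> eigenvalue (complex_mx D) z.
Proof.
case/right_eigenvalueP => v Mv v0; apply/right_eigenvalueP.
exists (\col_p v (b p) 0).
  apply/matrixP => p j; rewrite ord1 !mxE {j}.
  have /matrixP /(_ (b p) 0) := Mv; rewrite !mxE => <-.
  rewrite (partition_big b xpredT) //=; apply: eq_bigr => j _.
  rewrite mxE -DM raddf_sum /= mulr_suml; apply: eq_bigr => q /eqP <-.
  by rewrite !mxE.
apply: contra v0 => /eqP/matrixP v0; apply/eqP/matrixP => i j.
have [p <-] := b_surj i.
by have := v0 p 0; rewrite ord1 !mxE.
Qed.

Lemma normC_Re (z : R[i]) : `|z| = (complex.Re `|z|)%:C%C.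
Proof. by rewrite normc_def. Qed.

Hypothesis D0 : nonneg_mx D.

Lemma blocks_subinvariant z : eigenvalue (complex_mx D) z ->
  exists u : 'cV[R]_m, [/\ nonneg_mx u, u != 0
    & nonneg_mx (M *m u - complex.Re `|z| *: u)].
Proof.
case/right_eigenvalueP => w Dw w0.
pose a p : R := complex.Re `|w p 0|.
have aE p : `|w p 0| = (a p)%:C%C by rewrite normC_Re.
have a0 p : 0 <= a p by rewrite -lecR -aE normr_ge0.
have za p : complex.Re `|z| * a p <= \sum_q D p q * a q.
  rewrite -lecR rmorphM /= -aE -normC_Re raddf_sum /= -normrM.
  have /matrixP /(_ p 0) := Dw; rewrite !mxE => <-.
  rewrite (le_trans (ler_norm_sum _ _ _)) // ler_sum // => q _.
  by rewrite normrM mxE rmorphM /= -aE ger0_norm // lecR.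
(* The default 0 does not alter the maximum: [a] is non-negative and no block is empty. *)
pose u : 'cV[R]_m := \col_i \big[Num.max/0]_(p | b p == i) a p.
have au p : a p <= u (b p) 0.
  by rewrite mxE; apply: le_bigmax_cond.
have u0 : nonneg_mx u by move=> i j; rewrite mxE bigmax_ge_id.
exists u; split=> //.
  apply: contra w0 => /eqP u_eq0; apply/eqP/matrixP => p j; rewrite ord1 {j}.
  have := au p; rewrite u_eq0 mxE => ap0.
  have ap : a p = 0 by apply/eqP; rewrite eq_le ap0 a0.
  by apply/eqP; rewrite mxE -normr_eq0 aE ap.
have Mu p : \sum_q D p q * a q <= (M *m u) (b p) 0.
  rewrite mxE (partition_big b xpredT) //=; apply: ler_sum => j _.
  rewrite -DM mulr_suml; apply: ler_sum => q /eqP <-.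
  by rewrite ler_wpM2l.
move=> i j; rewrite ord1 {j}.
have -> : (M *m u - complex.Re `|z| *: u) i 0
  = (M *m u) i 0 - complex.Re `|z| * u i 0 by rewrite !mxE.
rewrite subr_ge0.
have [p0 p0i] := b_surj i.
have zge0 : 0 <= complex.Re `|z| by rewrite -lecR -normC_Re normr_ge0.
(* The maximum over block [i] is attained at some [p], and row [p] of [D] gives the inequality for
   row [i] of [M]. *)
have [p bp ->] : exists2 p, b p = i & u i 0 = a p.
  case: (@arg_maxP _ R _ p0 (fun p => b p == i) a) => [|p /eqP bp pmax].
    by rewrite p0i.
  exists p => //; apply/le_anti; rewrite -[X in _ && (_ <= u X _)]bp au andbT.
  by rewrite mxE bigmax_le // => q; apply: pmax.
by rewrite -bp (le_trans (za p)).
Qed.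

End Blocks.

Theorem proposition22 (R : realType) (m : nat) (M : 'M[R]_m) (hM : nonneg_mx M)
    (n : nat) (D : 'M[R]_n) (hD : nonneg_mx D) (hDil : Dil M D) :
  spectral_radius M = spectral_radius D.
Proof.
have [b [b_surj DM]] := dilated_blocks hDil.
(* A maximal modulus exists only in positive size; in size 0 both matrices are empty. *)
case: (posnP n) => [n0|n0].
  have m0 : m = 0%N.
    by case: (posnP m) => // m0; have [p _] := b_surj (Ordinal m0); move: (ltn_ord p); rewrite {2}n0.
  clear -m0 n0; subst m n.
  by rewrite (flatmx0 M) (flatmx0 D).
have m0 : (0 < m)%N by apply: leq_ltn_trans (ltn_ord (b (Ordinal n0))).
have [[z zM Mz] maxM] := spectral_radiusP M m0.
have [[y yD Dy] maxD] := spectral_radiusP D n0.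
apply/le_anti/andP; split.
  by rewrite -Mz; apply: maxD; exists z; [exact: (blocks_eigenvalue b_surj DM)|].
have [u [u0 un0 Mu]] := blocks_subinvariant b_surj DM hD yD.
have [t yt Mt] := subinvariant_eigenvalue hM u0 un0 Mu.
(* Passing through [t <= |t|] makes the bound the modulus of the eigenvalue [t] of [M]. *)
rewrite -Dy (le_trans yt) // (le_trans (ler_norm t)) //.
apply: maxM; exists t%:C%C; first by rewrite /mkset eigenvalue_map.
by rewrite normc_def /= expr0n addr0 sqrtr_sqr.
Qed.
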